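(* Let $n\geq 1$ and let $X_{1},X_{2},\ldots,X_n$ be symmetric independent identically distributed random variables with values in a separable Hilbert space $(\mathcal{H},|\cdot|)$, and let $S_k=\sum_{m=1}^k X_m$ for $1\leq k\leq n$. Let $j\geq 1$ be an integer. Then for any integer $i$ such that $\frac{n}{2^j}\leq i\leq n$, any positive real numbers $a_{i},\ldots,a_{n}$ and any $t\geq 0$, \[ \mathbb{P}\Big(\max_{i\leq k\leq n}\big||S_{k}|-a_{k}\big|\geq 19t\Big)\leq 6j\max_{i\leq k\leq n}\mathbb{P}\big(\big||S_{k}|-a_{k}\big|\geq t\big). \]
   Context: The random variables are defined on a common probability space with probability measure $\mathbb{P}$. A random vector $X$ is symmetric if $X$ and $-X$ have the same distribution. $|x|$ denotes the norm of $x\in\mathcal{H}$. *)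

(* Defs.v *)
From HB Require Import structures.
From mathcomp Require Import all_boot all_order all_algebra.
From mathcomp Require Import all_classical all_reals all_analysis.

Set Implicit Arguments.
Unset Strict Implicit.
Unset Printing Implicit Defensive.

Import Order.TTheory GRing.Theory Num.Theory.
Import numFieldNormedType.Exports.

Local Open Scope classical_set_scope.
Local Open Scope ring_scope.

(* Real Hilbert spaces.  A complex Hilbert space is covered too: with the real
   part of its inner product it is a real Hilbert space with the same norm. *)
HB.mixin Record CompleteNormedModule_isHilbert (R : realType) (H : Type)
    of CompleteNormedModule R H := {
  inner : {dot H for (@idfun R)};
  normE_inner : forall x : H, `|x| = Num.sqrt (inner x x)
}.

#[short(type="hilbertType")]
HB.structure Definition Hilbert (R : realType) :=
  {H of CompleteNormedModule R H & CompleteNormedModule_isHilbert R H}.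

Definition separable (T : topologicalType) :=
  exists2 D : set T, countable D & dense D.

Notation borel T := (g_sigma_algebraType (@open T)).

Section random_elements.
Context {d d' : measure_display} {T : measurableType d}
  {T' : measurableType d'} {R : realType} (P : probability T R).

Definition mutually_independent (I : finType) (X : I -> {RV P >-> T'}) :=
  forall (J : {set I}) (A : I -> set T'),
    (forall k, k \in J -> measurable (A k)) ->
    P (\bigcap_(k in [set` J]) (X k @^-1` A k)) =
    (\prod_(k in J) P (X k @^-1` A k))%E.

Definition same_distribution (X Y : T -> T') :=
  forall A : set T', measurable A -> pushforward P X A = pushforward P Y A.

Definition identically_distributed (I : finType) (X : I -> {RV P >-> T'}) :=
  forall k l, same_distribution (X k) (X l).

End random_elements.

Definition symmetric_rv (d : measure_display) (T : measurableType d)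
    (R : realType) (P : probability T R) (H : hilbertType R)
    (X : {RV P >-> borel H}) :=
  same_distribution P X (fun w => - (X w : H) : borel H).

Arguments mutually_independent {d d' T T' R} P {I} X.
Arguments identically_distributed {d d' T T' R} P {I} X.
Arguments symmetric_rv {d T R} P {H} X.

(* The variables $X_1, ..., X_n$ are indexed from 0 here: [X m] stands for $X_{m+1}$. *)
Definition partial_sum (d : measure_display) (T : measurableType d)
    (R : realType) (P : probability T R) (H : hilbertType R) (n : nat)
    (X : 'I_n -> {RV P >-> borel H}) (k : nat) (w : T) : H :=
  \sum_(m < n | (m < k)%N) (X m w : H).

(* Main.v *)
Require Import Defs.
From HB Require Import structures.
From mathcomp Require Import all_boot all_order all_algebra.
From mathcomp Require Import all_classical all_reals all_analysis.
From mathcomp Require Import zify lra.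

Set Implicit Arguments.
Unset Strict Implicit.
Unset Printing Implicit Defensive.

Import Order.TTheory GRing.Theory Num.Theory.
Import numFieldNormedType.Exports.

Local Open Scope classical_set_scope.
Local Open Scope ring_scope.

(* Let [q] be the maximum on the right; only [q < 1/6] matters.  Suppose first
   [N <= 2 i] and put [D = S_N - S_k] for [i <= k <= N].  If a vector [s] satisfies
   [P(||s + D| - a_N| >= t) < 1/6], then by symmetry of [D] some outcome puts
   [|s +- D|] and [|S_k +- D|] within [t] of [a_N], and [|S_k|] within [t] of
   [a_k]; the parallelogram identity then makes [|s|^2] and [|S_k|^2] close up to
   [O(t (a_N + t))].  As [D] has at most [k] summands, its tails are at most twice
   those of [S_k], so [a_N < 2 a_k + 3 t], and [||s| - a_k| < 19 t] follows.
   Hence, once [||S_k| - a_k| >= 19 t] happens, [||S_N| - a_N| >= t] has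
   conditional probability at least [1/6]; applied at the first such [k], this
   bounds the probability of the maximal event by [6 q].  The general case covers
   [i, n] by [j] intervals [M, N] with [N <= 2 M]. *)

(** * Borel measurability of norms and sums in a separable Hilbert space *)

Lemma norm_subD_lt (R : numDomainType) (V : normedZmodType R)
    (a b p q x y : V) (e : R) :
  `|a - p| < e -> `|b - q| < e -> `|a - x| < e -> `|b - y| < e ->
  `|p + q - (x + y)| < 4 * e.
Proof.
move=> ap bq ax yb.
have -> : p + q - (x + y) = (a - x) - (a - p) + ((b - y) - (b - q)).
  rewrite !opprB opprD addrACA; congr (_ + _).
    by rewrite [RHS]addrC addrA subrK.
  by rewrite [RHS]addrC addrA subrK.
apply: (le_lt_trans (ler_normD _ _)).
rewrite (_ : 4 * e = (e + e) + (e + e)); last first.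
  by rewrite -!mulr2n -mulrnA mulr_natl.
by apply: ltrD; apply: (le_lt_trans (ler_normB _ _)); exact: ltrD.
Qed.

Section borel_measurability.
Context (R : realType) (H : hilbertType R).

Lemma closed_measurable (A : set H) :
  closed A -> measurable (A : set (borel H)).
Proof.
move=> cA; rewrite -[A]setCK; apply: measurableC.
by apply: sub_sigma_algebra; exact: closed_openC.
Qed.

Lemma closed_dist_norm_ge (a t : R) : closed [set x : H | t <= `| `|x| - a |].
Proof.
rewrite (_ : mkset _ = (fun x : H => `| `|x| - a |) @^-1` [set y | t <= y])//.
apply: closed_comp; last exact: closed_ge.
move=> x _; apply: cvg_norm; apply: cvgB; last exact: cvg_cst.
exact: cvg_norm.
Qed.

Lemma measurable_dist_norm_ge (a t : R) :
  measurable ([set x | t <= `| `|x : H| - a |] : set (borel H)).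
Proof. by apply: closed_measurable; exact: closed_dist_norm_ge. Qed.

Lemma measurable_norm_ge (u : R) :
  measurable ([set x | u <= `|x : H|] : set (borel H)).
Proof.
apply: closed_measurable.
rewrite (_ : mkset _ = (fun x : H => `|x|) @^-1` [set y | u <= y])//.
by apply: closed_comp; [move=> x _; exact: cvg_norm|exact: closed_ge].
Qed.

Lemma measurable_funN_borel d (T : measurableType d) (f : T -> borel H) :
  measurable_fun setT f ->
  measurable_fun setT (fun w => - (f w : H) : borel H).
Proof.
move=> mf; apply: (@measurability _ _ T (borel H) setT _ (@open H)) => //.
move=> _ [A oA <-]; rewrite setTI.
rewrite (_ : _ @^-1` A = f @^-1` [set x : H | A (- x)])//.
rewrite -[_ @^-1` _]setTI; apply: mf => //; apply: sub_sigma_algebra.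
rewrite (_ : mkset _ = (fun x : H => - x) @^-1` A)//.
by apply: open_comp => // x _; exact: oppr_continuous.
Qed.

(** Separability writes the preimage of an open [U] as a countable union of events that put [f] and
    [g] in balls centred at points of a dense sequence. *)
Lemma measurable_funD_borel (hH : separable H) d (T : measurableType d)
    (f g : T -> borel H) :
  measurable_fun setT f -> measurable_fun setT g ->
  measurable_fun setT (fun w => (f w : H) + (g w : H) : borel H).
Proof.
move=> mf mg; apply: (@measurability _ _ T (borel H) setT _ (@open H)) => //.
move=> _ [U oU <-]; rewrite setTI.
have [D cD dD] := hH.
have /pfcard_geP[D0|[e]] := cD.
  have := dD setT; rewrite D0 setI0 => /(_ _ openT)[].
    by exists 0.
  by move=> x [].
(* [Q p] says that addition sends the product of the two balls named by [p] into [U]; only such [p]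
   contribute to the union. *)
pose Q (p : nat * nat * nat) := forall a b : H,
  `|e p.1.1 - a| < p.2.+1%:R^-1 -> `|e p.1.2 - b| < p.2.+1%:R^-1 -> U (a + b).
pose F (p : nat * nat * nat) :=
  f @^-1` (ball (e p.1.1 : H) p.2.+1%:R^-1) `&`
  g @^-1` (ball (e p.1.2 : H) p.2.+1%:R^-1).
have mF p : measurable (F p).
  by apply: measurableI; rewrite -[X in measurable X]setTI; [apply: mf|apply: mg] => //;
    apply: sub_sigma_algebra; exact: ball_open.
rewrite (_ : _ @^-1` U = \bigcup_p (if `[<Q p>] then F p else set0)).
  apply: countable_bigcupT_measurable; first exact: countableP.
  by move=> p; case: ifP.
apply/seteqP; split => w /=; last first.
  move=> [p _]; case: asboolP => // Qp [].
  by rewrite -!ball_normE/= => h1 h2; exact: Qp.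
move=> Uw.
have /nbhs_ballP[r /= r0 rU] : nbhs ((f w : H) + (g w : H)) U.
  by apply: open_nbhs_nbhs; split.
(* The quarter makes up for the factor 4 in [norm_subD_lt], which compares two sums through the
   centres of both balls. *)
have [k kr] : exists k : nat, k.+1%:R^-1 < r / 4.
  exists (Num.truncn (r / 4)^-1).
  rewrite -[ltRHS]invrK ltf_pV2 ?posrE ?invr_gt0 ?divr_gt0 ?ltr0n//.
  exact: truncnS_gt.
have k0 : (0 : R) < k.+1%:R^-1 by rewrite invr_gt0.
have pt (x : H) : exists m, `|e m - x| < k.+1%:R^-1.
  have [|y [xy Dy]] := dD (ball x k.+1%:R^-1) _ (ball_open _ _).
    by exists x; exact: ballxx.
  have [m _ my] := 'surj_e Dy; exists m; rewrite my distrC.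
  by move: xy; rewrite -ball_normE.
have [[a ha] [b hb]] := (pt (f w), pt (g w)).
exists (a, b, k) => //; case: asboolP => [_|[]].
  by split; rewrite /= -ball_normE.
move=> x y /= hx hy; apply: rU; rewrite -ball_normE /=.
apply: lt_le_trans (norm_subD_lt ha hb hx hy) _.
by rewrite mulrC -ler_pdivlMr// ltW.
Qed.

End borel_measurability.

(** * The parallelogram identity and rigidity of norms *)

Lemma parallelogram (R : realType) (H : hilbertType R) (x y : H) :
  `|x + y| ^+ 2 + `|x - y| ^+ 2 = 2 * (`|x| ^+ 2 + `|y| ^+ 2).
Proof.
have h (z : H) : `|z| ^+ 2 = inner z z.
  rewrite normE_inner sqr_sqrtr//.
  have [->|z0] := eqVneq z 0; first by rewrite linear0l.
  exact/ltW/neq0_dnorm_gt0.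
rewrite !h !linearDl !linearDr !linearNl !linearNr/=.
lra.
Qed.

(** Factor the left side as [(p - q) * (p + q)], where [p - q < 2 * t] and [p + q < 2 * (b + t)]. *)
Lemma ltr_sqr_sub (R : realFieldType) (p q b t : R) :
  0 <= p -> 0 <= q -> `|p - b| < t -> `|q - b| < t ->
  p ^+ 2 - q ^+ 2 < 4 * t * (b + t).
Proof.
move=> p0 q0; rewrite !ltr_norml => /andP[p1 p2] /andP[q1 q2].
have [pq|qp] := leP p q; first by nra.
by nra.
Qed.

(* By the parallelogram identity the four hypotheses on [s +- x] and [y +- x]
   squeeze [|s|^2 - |y|^2] between [+- 4 t (b + t)]. *)
Lemma norm_rigidity (R : realType) (H : hilbertType R) (s y x : H) (a b t : R) :
  0 < a -> b < 2 * a + 3 * t ->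
  `| `|s + x| - b | < t -> `| `|s - x| - b | < t ->
  `| `|y + x| - b | < t -> `| `|y - x| - b | < t ->
  `| `|y| - a | < t -> `| `|s| - a | < 19 * t.
Proof.
move=> a0 ba s1 s2 y1 y2 ya.
have := parallelogram s x; have := parallelogram y x.
have := ltr_sqr_sub (normr_ge0 _) (normr_ge0 _) s1 y1.
have := ltr_sqr_sub (normr_ge0 _) (normr_ge0 _) s2 y2.
have := ltr_sqr_sub (normr_ge0 _) (normr_ge0 _) y1 s1.
have := ltr_sqr_sub (normr_ge0 _) (normr_ge0 _) y2 s2.
move: (normr_ge0 s) (normr_ge0 y) ya.
move: (`|s + x| ^+ 2) (`|s - x| ^+ 2) (`|y + x| ^+ 2) (`|y - x| ^+ 2).
move: `|s| `|y| (`|x| ^+ 2) => {s1 s2 y1 y2} {}s {}y {}x p1 p2 q1 q2.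
rewrite !ltr_norml => s0 y0 /andP[ya1 ya2] h1 h2 h3 h4 e1 e2.
have t0 : 0 < t by lra.
have d1 : s ^+ 2 - y ^+ 2 < 4 * t * (2 * a + 4 * t) by nra.
have d2 : y ^+ 2 - s ^+ 2 < 4 * t * (2 * a + 4 * t) by nra.
(* Either violation contradicts [d1] or [d2]. If [s <= a - 19 * t], then [y - s >= 18 * t],
   [y + s >= a - t] and [a >= 19 * t]; if [s >= a + 19 * t], then [s - y >= 18 * t] and
   [s + y >= 2 * a + 18 * t]. *)
apply/andP; split; rewrite ltNge; apply/negP => hs.
  have : 18 * t * (a - t) <= (y - s) * (y + s) by apply: ler_pM; nra.
  by nra.
have : 18 * t * (2 * a + 18 * t) <= (s - y) * (s + y) by apply: ler_pM; nra.
by nra.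
Qed.

(** * Independence of generated sigma-algebras and laws of independent pairs *)

Section independence.
Context d (T : measurableType d) (R : realType) (P : probability T R).
Local Open Scope ereal_scope.

(** As functions of [A], both sides are finite measures that agree on the pi-system [G], hence on
    the sigma-algebra it generates. *)
Lemma indep_sigma_algebra_l (G : set (set T)) (B : set T) :
  setI_closed G -> G `<=` measurable -> G setT -> measurable B ->
  (forall A, G A -> P (A `&` B) = P A * P B) ->
  forall A, <<s G >> A -> P (A `&` B) = P A * P B.
Proof.
move=> GI Gm GT mB GB A sA.
have PB0 : (0 <= fine (P B))%R by exact: fine_ge0.
pose m2 := mscale (NngNum PB0) P.
have m2E C : m2 C = P C * P B.
  by rewrite /m2 /mscale/= fineK ?fin_num_measure// muleC.
rewrite -m2E.
apply: (g_sigma_algebra_measure_unique G Gm (fun=> setT) _ _ (mrestr P mB) m2)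
  => //.
- by rewrite bigcup_const.
- by move=> C GC; exact: etrans (GB C GC) (esym (m2E C)).
- by move=> _; rewrite /= /mrestr setTI (le_lt_trans (probability_le1 P mB))// ltry.
Qed.

Lemma indep_sigma_algebra (G1 G2 : set (set T)) :
  setI_closed G1 -> G1 `<=` measurable -> G1 setT ->
  setI_closed G2 -> G2 `<=` measurable -> G2 setT ->
  (forall A B, G1 A -> G2 B -> P (A `&` B) = P A * P B) ->
  forall A B, <<s G1 >> A -> <<s G2 >> B -> P (A `&` B) = P A * P B.
Proof.
move=> I1 m1 T1 I2 m2 T2 G12 A B sA sB.
have mB : measurable B by exact: (smallest_sub (@sigma_algebra_measurable _ T) m2).
apply: (indep_sigma_algebra_l I1 m1 T1 mB) => // {sA}A GA.
rewrite setIC muleC; apply: (indep_sigma_algebra_l I2 m2 T2 (m1 _ GA)) => // C GC.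
by rewrite setIC muleC; exact: G12.
Qed.

Lemma measurable_fun_RV d' (T' : measurableType d') (f : T -> T') :
  measurable_fun setT f -> {X : {RV P >-> T'} | X = f :> (T -> T')}.
Proof. by move=> mf; exists (mfun_Sub (mem_set mf)). Qed.

(** Rectangles determine a finite measure on the product. [X'] and [Y'] may differ from [X] and [Y],
    so that a component can be exchanged for another with the same law. *)
Lemma joint_law d1 d2 (T1 : measurableType d1) (T2 : measurableType d2)
    (X X' : {RV P >-> T1}) (Y Y' : {RV P >-> T2}) :
  (forall A B, measurable A -> measurable B ->
    P (X @^-1` A `&` Y @^-1` B) = P (X' @^-1` A) * P (Y' @^-1` B)) ->
  forall C : set (T1 * T2), measurable C ->
  P ((fun w => (X w, Y w)) @^-1` C) =
  (distribution P X' \x distribution P Y') C.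
Proof.
move=> XY C mC.
have mXY : measurable_fun setT (fun w => (X w, Y w)).
  by apply: measurable_fun_pair.
have [Z ZE] := measurable_fun_RV mXY.
rewrite -ZE -[LHS]/(distribution P Z C).
apply/esym; apply: product_measure_unique => // A B mA mB.
by rewrite /= /distribution /pushforward ZE; exact: XY.
Qed.

(** By Fubini the right side is the integral over [E], for the law of [X], of the probability that
    [Y] lies in the section of [C]; the integrand is at least [c]. *)
Lemma joint_law_ge d1 d2 (T1 : measurableType d1) (T2 : measurableType d2)
    (X : {RV P >-> T1}) (Y : {RV P >-> T2}) (E : set T1) (C : set (T1 * T2))
    (c : R) :
  (forall A B, measurable A -> measurable B ->
    P (X @^-1` A `&` Y @^-1` B) = P (X @^-1` A) * P (Y @^-1` B)) ->
  measurable E -> measurable C -> (0 <= c)%R ->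
  (forall x, E x -> c%:E <= P (Y @^-1` xsection C x)) ->
  c%:E * P (X @^-1` E) <= P (X @^-1` E `&` (fun w => (X w, Y w)) @^-1` C).
Proof.
move=> XY mE mC c0 hE.
pose D := C `&` (E `*` setT).
have mD : measurable D by apply: measurableI => //; exact: measurableX.
have -> : X @^-1` E `&` (fun w => (X w, Y w)) @^-1` C =
    (fun w => (X w, Y w)) @^-1` D.
  by apply/seteqP; split => w /=; [move=> [? ?]|move=> [? [? _]]].
rewrite (joint_law XY mD) /product_measure1.
rewrite -[P _]/(distribution P X E) -integral_cst//.
have mx := measurable_fun_xsection (distribution P Y) mD.
apply: (@le_trans _ _ (\int[distribution P X]_(x in E)
    (distribution P Y \o xsection D) x)); last first.
  exact: ge0_subset_integral.
apply: ge0_le_integral => //.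
  exact: measurable_funS mx.
move=> x Ex; rewrite /= (_ : xsection D x = xsection C x); first exact: hE.
by apply/seteqP; split => y; rewrite /xsection/= !inE /D//= => -[].
Qed.

End independence.

(** * Signed sums over lists of indices, independent on disjoint lists *)

Section signed_sums.
Context (R : realType) (H : hilbertType R) (hH : separable H).
Context (d : measure_display) (T : measurableType d) (P : probability T R).
Context (n : nat) (X : 'I_n -> {RV P >-> borel H}).

(** A pi-system generating the sigma-algebra of the [X m] with [m \in J]. *)
Definition cylinders (J : {set 'I_n}) : set (set T) :=
  [set A | exists2 B : 'I_n -> set (borel H), (forall m, measurable (B m)) &
    A = \bigcap_(m in [set` J]) (X m @^-1` B m)].

Lemma cylindersT (J : {set 'I_n}) : cylinders J setT.
Proof.
exists (fun=> setT) => //; apply/esym.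
by rewrite -subTset => w _ m _.
Qed.

Lemma cylinders_setI (J : {set 'I_n}) : setI_closed (cylinders J).
Proof.
move=> _ _ [B mB ->] [C mC ->]; exists (fun m => B m `&` C m).
  by move=> m; exact: measurableI.
by rewrite -bigcapI.
Qed.

Lemma cylinders_measurable (J : {set 'I_n}) : cylinders J `<=` measurable.
Proof.
move=> _ [B mB ->]; apply: fin_bigcap_measurable => // m _.
by rewrite -[X in measurable X]setTI; exact: measurable_funP.
Qed.

Lemma cylinders_sub_measurable (J : {set 'I_n}) :
  <<s cylinders J >> `<=` measurable.
Proof.
apply: smallest_sub; last exact: cylinders_measurable.
exact: sigma_algebra_measurable.
Qed.

Lemma cylinders_indep (Xindep : mutually_independent P X)
    (J K : {set 'I_n}) (A B : set T) :
  (forall m, m \in J -> m \notin K) -> <<s cylinders J >> A -> <<s cylinders K >> B ->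
  P (A `&` B) = (P A * P B)%E.
Proof.
move=> JK; apply: indep_sigma_algebra; try exact: cylinders_setI;
  try exact: cylinders_measurable; try exact: cylindersT.
move=> {A B} _ _ [A mA ->] [B mB ->].
(* One family of Borel sets serves [J :|: K]: it is [A] on [J] and, by disjointness, [B] on [K], so
   mutual independence applies to all indices at once. *)
pose C m := if m \in J then A m else B m.
have mC m : measurable (C m) by rewrite /C; case: ifP.
have CA : \bigcap_(m in [set` J]) (X m @^-1` A m) =
    \bigcap_(m in [set` J]) (X m @^-1` C m).
  by apply: eq_bigcapr => m; rewrite /C/= => ->.
have CB : \bigcap_(m in [set` K]) (X m @^-1` B m) =
    \bigcap_(m in [set` K]) (X m @^-1` C m).
  apply: eq_bigcapr => m; rewrite /C/= => mK.
  by case: ifPn => // mJ; move: (JK _ mJ); rewrite mK.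
rewrite CA CB -bigcap_setU (_ : [set` J] `|` [set` K] = [set` J :|: K]).
  rewrite !Xindep// (bigID (mem J))/=; congr (_ * _)%E; apply: eq_bigl => m.
    by rewrite finset.in_setU; case: (m \in J); rewrite ?andbF ?andbT.
  rewrite finset.in_setU; case: (boolP (m \in J)) => [mJ|_]; last exact: andbT.
  by rewrite andbF (negbTE (JK _ mJ)).
by apply/seteqP; split => m /=; rewrite finset.in_setU => /orP.
Qed.

Definition signed_sum (e : 'I_n -> bool) (r : seq 'I_n) (w : T) : borel H :=
  (\sum_(m <- r) (if e m then - (X m w : H) else (X m w : H))) : H.

Lemma signed_sum_cons e m r w : signed_sum e (m :: r) w =
  ((if e m then - (X m w : H) else (X m w : H)) + (signed_sum e r w : H))%R.
Proof. by rewrite /signed_sum big_cons. Qed.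

Lemma signed_sum_cat e r s w : signed_sum e (r ++ s) w =
  ((signed_sum e r w : H) + (signed_sum e s w : H))%R.
Proof. by rewrite /signed_sum big_cat. Qed.

(** The sigma-algebra is that of the variables in [J] alone: this gives independence of sums over
    disjoint lists, and later the events decided by the first [K] variables. *)
Lemma measurable_signed_sum_cylinders e (r : seq 'I_n) (J : {set 'I_n}) :
  {subset r <= J} ->
  measurable_fun (setT : set (g_sigma_algebraType (cylinders J)))
    (signed_sum e r).
Proof.
elim: r => [|m r IH] rJ.
  rewrite (_ : signed_sum e [::] = cst (0 : H)); first exact: measurable_cst.
  by apply/funext => w; rewrite /signed_sum big_nil.
rewrite (_ : signed_sum e (m :: r) = fun w =>
  ((if e m then - (X m w : H) else (X m w : H)) + (signed_sum e r w : H))%R);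
  last by apply/funext => w; rewrite signed_sum_cons.
apply: measurable_funD_borel => //; last first.
  by apply: IH => k kr; apply: rJ; rewrite inE kr orbT.
have mX : measurable_fun (setT : set (g_sigma_algebraType (cylinders J))) (X m).
  move=> _ B mB; apply: sub_sigma_algebra.
  exists (fun k => if k == m then B else setT); first by move=> k; case: ifP.
  rewrite setTI; apply/seteqP; split => w /=.
    by move=> Bw k _; case: eqP => // ->.
  by move=> /(_ m); rewrite /= eqxx; apply; apply: rJ; rewrite inE eqxx.
by case: (e m) => //; exact: measurable_funN_borel.
Qed.

Lemma measurable_signed_sum e (r : seq 'I_n) :
  measurable_fun setT (signed_sum e r).
Proof.
move=> _ B mB; rewrite setTI; apply: (@cylinders_sub_measurable finset.setT).
rewrite -[_ @^-1` _]setTI.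
by apply: (@measurable_signed_sum_cylinders e r finset.setT) => // m _; rewrite inE.
Qed.

Lemma signed_sum_indep (Xindep : mutually_independent P X) e e'
    (r s : seq 'I_n) (A B : set (borel H)) :
  (forall m, m \in r -> m \notin s) -> measurable A -> measurable B ->
  P (signed_sum e r @^-1` A `&` signed_sum e' s @^-1` B) =
  (P (signed_sum e r @^-1` A) * P (signed_sum e' s @^-1` B))%E.
Proof.
move=> rs mA mB.
apply: (@cylinders_indep Xindep [set m in r]%SET [set m in s]%SET).
- by move=> m; rewrite !inE; exact: rs.
- rewrite -[_ @^-1` _]setTI; apply: measurable_signed_sum_cylinders => //.
  by move=> m; rewrite inE.
- rewrite -[_ @^-1` _]setTI; apply: measurable_signed_sum_cylinders => //.
  by move=> m; rewrite inE.
Qed.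

End signed_sums.

(** * Union bounds *)

Section probability_bounds.
Context d (T : measurableType d) (R : realType) (P : probability T R).

Lemma probabilityU_le (A B : set T) (x y : R) :
  measurable A -> measurable B -> (P A <= x%:E)%E -> (P B <= y%:E)%E ->
  (P (A `|` B) <= (x + y)%:E)%E.
Proof.
move=> mA mB Ax By; rewrite EFinD; apply: le_trans (leeD Ax By).
exact: measureU2.
Qed.

(** Selects an outcome that avoids several unlikely events, once their union has probability below
    1. *)
Lemma probability_ex_notin (A : set T) (x : R) :
  (P A <= x%:E)%E -> x < 1 -> exists w, ~ A w.
Proof.
move=> Ax x1; apply/existsNP => hA.
have := Ax; rewrite (_ : A = setT) ?probability_setT; last by rewrite -subTset.
by rewrite lee_fin leNgt x1.
Qed.

End probability_bounds.

(** * Equality in law of signed sums *)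

Section iid_symmetric.
Context (R : realType) (H : hilbertType R) (hH : separable H).
Context (d : measure_display) (T : measurableType d) (P : probability T R).
Context (n : nat) (X : 'I_n -> {RV P >-> borel H}).
Hypotheses (Xsym : forall m, symmetric_rv P (X m))
  (Xindep : mutually_independent P X) (Xid : identically_distributed P X).

Let measurableD_pair : measurable_fun setT
  (fun p : borel H * borel H => (p.1 : H) + (p.2 : H) : borel H).
Proof.
apply: (measurable_funD_borel hH); first exact: measurable_fst.
exact: measurable_snd.
Qed.

Let measurable_ss e r : measurable_fun setT (signed_sum X e r).
Proof. exact: measurable_signed_sum. Qed.

Lemma signed_sum1_same_distribution e e' (m m' : 'I_n) :
  same_distribution P (signed_sum X e [:: m]) (signed_sum X e' [:: m']).
Proof.
have signE f k A : measurable A ->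
    pushforward P (signed_sum X f [:: k]) A = pushforward P (X k) A.
  move=> mA; case fk : (f k).
    rewrite (Xsym k mA); congr (pushforward P _ A); apply/funext => w.
    by rewrite /signed_sum big_seq1 fk.
  congr (pushforward P _ A); apply/funext => w.
  by rewrite /signed_sum big_seq1 fk.
by move=> A mA; rewrite !signE//; exact: Xid.
Qed.

(** Only the number of summands matters: symmetry absorbs each sign, identical distribution each
    index, and independence makes the law of head and tail a product, so the induction goes
    through. *)
Lemma signed_sum_same_distribution e e' (r r' : seq 'I_n) :
  uniq r -> uniq r' -> size r = size r' ->
  same_distribution P (signed_sum X e r) (signed_sum X e' r').
Proof.
elim: r r' => [|m r IH] [|m' r']//=.
  move=> _ _ _ A mA; rewrite (_ : signed_sum X e [::] = signed_sum X e' [::])//.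
  by apply/funext => w; rewrite /signed_sum !big_nil.
move=> /andP[mr ur] /andP[mr' ur'] [srr'] A mA.
pose C : set (borel H * borel H) := [set p | A ((p.1 : H) + (p.2 : H))].
have mC : measurable C.
  by rewrite -[C]setTI; exact: measurableD_pair.
have decomp f k s : signed_sum X f (k :: s) @^-1` A =
    (fun w => (signed_sum X f [:: k] w, signed_sum X f s w)) @^-1` C.
  by apply/funext => w; rewrite /preimage/= -cat1s signed_sum_cat.
rewrite /pushforward !decomp.
have [Y YE] := measurable_fun_RV P (measurable_ss e [:: m]).
have [Z ZE] := measurable_fun_RV P (measurable_ss e r).
have [Y' YE'] := measurable_fun_RV P (measurable_ss e' [:: m']).
have [Z' ZE'] := measurable_fun_RV P (measurable_ss e' r').
rewrite -YE -ZE -YE' -ZE' (@joint_law _ _ _ P _ _ _ _ Y Y Z Z)//; last first.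
  move=> B D mB mD; rewrite YE ZE signed_sum_indep//.
  by move=> k; rewrite inE => /eqP->.
rewrite (@joint_law _ _ _ P _ _ _ _ Y' Y Z' Z)// => B D mB mD.
rewrite YE ZE YE' ZE' signed_sum_indep//; last first.
  by move=> k; rewrite inE => /eqP->.
congr (_ * _)%E; first exact/esym/signed_sum1_same_distribution.
exact/esym/IH.
Qed.

(** * Blocks of consecutive indices, increments and reflections *)

Definition block (k N : nat) : seq 'I_n :=
  [seq m : 'I_n <- index_enum 'I_n | (k <= m < N)%N].

Lemma block_uniq k N : uniq (block k N).
Proof. exact/filter_uniq/index_enum_uniq. Qed.

Lemma mem_block k N m : (m \in block k N) = (k <= m < N)%N.
Proof. by rewrite mem_filter mem_index_enum andbT. Qed.

Lemma size_block k N : (N <= n)%N -> size (block k N) = (N - k)%N.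
Proof.
move=> Nn; rewrite size_filter -sum1_count.
rewrite -(big_mkord (fun m => k <= m < N)%N (fun=> 1%N)).
rewrite -(big_nat_widen _ _ _ (fun m => k <= m)%N)//.
by rewrite -(big_nat_widenl _ _ _ predT)//= sum_nat_const_nat muln1.
Qed.

Local Notation S := (partial_sum X).
Local Notation D := (fun k N => signed_sum X (fun=> false) (block k N)).

Lemma partial_sum_block k w : S k w = D 0%N k w.
Proof. by rewrite /signed_sum big_filter. Qed.

Lemma signed_sum_block e k N w : (k <= N)%N ->
  signed_sum X e (block 0 N) w =
  ((signed_sum X e (block 0 k) w : H) + (signed_sum X e (block k N) w : H))%R.
Proof.
move=> kN; rewrite /signed_sum !big_filter.
rewrite (bigID (fun m : 'I_n => (m < k)%N))/=; congr (_ + _); apply: eq_bigl => m.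
  by apply: andb_idl => /leq_trans; apply.
by rewrite -leqNgt andbC.
Qed.

Lemma eq_signed_sum e e' (r : seq 'I_n) w :
  {in r, e =1 e'} -> signed_sum X e r w = signed_sum X e' r w.
Proof. by move=> ee; apply: eq_big_seq => m mr; rewrite ee. Qed.

Lemma signed_sumN (r : seq 'I_n) w :
  signed_sum X (fun=> true) r w = (- (signed_sum X (fun=> false) r w : H) : H).
Proof. by rewrite /signed_sum sumrN. Qed.

Lemma partial_sumD k N w : (k <= N)%N -> S N w = S k w + (D k N w : H).
Proof. by move=> kN; rewrite !partial_sum_block (signed_sum_block _ _ kN). Qed.

Lemma partial_sum_flip k N w : (k <= N)%N ->
  S k w - (D k N w : H) = signed_sum X (fun m => (k <= m)%N) (block 0 N) w.
Proof.
move=> kN; rewrite (signed_sum_block _ _ kN) partial_sum_block -signed_sumN.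
congr (_ + _); apply: eq_signed_sum => m; rewrite mem_block.
  by move=> /andP[_ mk]; rewrite leqNgt mk.
by move=> /andP[-> _].
Qed.

Lemma measurable_partial_sum k :
  measurable_fun setT (S k : T -> borel H).
Proof.
rewrite (_ : S k = D 0%N k); first exact: measurable_ss.
by apply/funext => w; exact: partial_sum_block.
Qed.

(** Negating the summands after the first [k] turns [S N] into another signed sum over the same
    indices. *)
Lemma partial_sum_reflection k N (A : set (borel H)) : (k <= N)%N ->
  measurable A ->
  P [set w | A (S k w - (D k N w : H))] = P [set w | A (S N w)].
Proof.
move=> kN mA.
have := @signed_sum_same_distribution (fun m => (k <= m)%N) (fun=> false)
  (block 0 N) (block 0 N) (block_uniq _ _) (block_uniq _ _) erefl A mA.
rewrite /pushforward => E.
rewrite -[LHS]/(P ((fun w => S k w - (D k N w : H)) @^-1` A)).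
rewrite -[RHS]/(P (S N @^-1` A)).
rewrite (_ : (fun w => _ - _) = signed_sum X (fun m => (k <= m)%N) (block 0 N)).
  rewrite E; congr (P (_ @^-1` A)); apply/funext => w.
  by rewrite partial_sum_block.
by apply/funext => w; rewrite partial_sum_flip.
Qed.

Lemma increment_reflection k N (A : set (borel H)) : measurable A ->
  P [set w | A (- (D k N w : H))] = P [set w | A (D k N w)].
Proof.
move=> mA.
have := @signed_sum_same_distribution (fun=> true) (fun=> false)
  (block k N) (block k N) (block_uniq _ _) (block_uniq _ _) erefl A mA.
rewrite /pushforward => <-; congr (P _); apply/funext => w.
by rewrite /preimage/= signed_sumN.
Qed.

(* [D k N] has at most as many summands as [S k]; completing it by further
   summands [r] makes [D + r] and [- D + r] distributed as [S k], and
   [2 |D| <= |D + r| + |- D + r|]. *)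
Lemma increment_tail k N (u x : R) : (k <= N <= n)%N -> (N <= k.*2)%N ->
  (P [set w | u <= `|S k w|]%R <= x%:E)%E ->
  (P [set w | u <= `|D k N w : H|]%R <= (x + x)%:E)%E.
Proof.
move=> /andP[kN Nn] N2k hx.
have kn := leq_trans kN Nn.
(* The list [r] holds [2 k - N] early indices, disjoint from the block, so that [block k N ++ r] has
   exactly [k] elements, like [block 0 k]. *)
pose r := take (k - (N - k)) (block 0 k).
pose e (m : 'I_n) := (k <= m)%N.
have rk m : m \in r -> (m < k)%N by move=> /mem_take; rewrite mem_block.
pose A : set (borel H) := [set y | u <= `|y : H|].
have mA : measurable A by exact: measurable_norm_ge.
have tail f : (P (signed_sum X f (block k N ++ r) @^-1` A) <= x%:E)%E.
  have := @signed_sum_same_distribution f (fun=> false)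
    (block k N ++ r) (block 0 k) _ (block_uniq _ _) _ A mA.
  rewrite /pushforward => ->.
  - rewrite (_ : _ @^-1` A = [set w | u <= `|S k w|])//.
    by apply/funext => w; rewrite /preimage/= /A/= partial_sum_block.
  - rewrite cat_uniq block_uniq take_uniq ?block_uniq// andbT /=.
    apply/hasPn => m /rk mk; rewrite /= mem_block negb_and -ltnNge.
    by rewrite mk.
  - by rewrite size_cat size_block// size_takel size_block//; lia.
have mS f : measurable (signed_sum X f (block k N ++ r) @^-1` A).
  by rewrite -[_ @^-1` _]setTI; exact: measurable_ss.
apply: le_trans (probabilityU_le (mS _) (mS _) (tail (fun=> false)) (tail e)).
apply: le_measure; rewrite ?inE.
- rewrite (_ : mkset _ = D k N @^-1` A)// -[_ @^-1` _]setTI.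
  exact: measurable_ss.
- exact: measurableU.
move=> w /= uD; rewrite /A/= !signed_sum_cat.
have -> : signed_sum X e (block k N) w = (- (D k N w : H) : H).
  rewrite -signed_sumN; apply: eq_signed_sum => m.
  by rewrite mem_block /e => /andP[-> _].
have -> : signed_sum X e r w = signed_sum X (fun=> false) r w.
  by apply: eq_signed_sum => m /rk mk; rewrite /e leqNgt mk.
move: (D k N w) (signed_sum X _ r w) uD => a b ua.
(* If both norms were below [u], then [2 a = (a + b) - (- a + b)] would have norm below [2 u]. *)
apply/orP; rewrite -[_ || _]negbK negb_or -!ltNge; apply/negP => /andP[h1 h2].
have : `|(a : H) *+ 2| < u + u.
  rewrite (_ : (a : H) *+ 2 = ((a : H) + (b : H)) - (- (a : H) + (b : H))).
    by apply: le_lt_trans (ler_normB _ _) _; exact: ltrD.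
  by rewrite opprD opprK addrACA subrr addr0 mulr2n.
by rewrite normrMn mulr2n ltNge lerD.
Qed.

(** * Escape of the shifted increment *)

Lemma measurable_shift_dist_norm_ge (s : H) (b t : R) :
  measurable ([set x | t <= `| `|s + (x : H)| - b |] : set (borel H)).
Proof.
apply: closed_measurable.
rewrite (_ : mkset _ = (+%R s) @^-1` [set x : H | t <= `| `|x| - b |])//.
apply: closed_comp; last exact: closed_dist_norm_ge.
by move=> x _; apply: cvgD; [exact: cvg_cst|exact: cvg_id].
Qed.

Lemma measurable_dist_partial_sum k (b t : R) :
  measurable [set w | t <= `| `|S k w| - b |].
Proof.
rewrite (_ : mkset _ = S k @^-1` [set x : H | t <= `| `|x| - b |])//.
rewrite -[_ @^-1` _]setTI; apply: measurable_partial_sum => //.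
exact: measurable_dist_norm_ge.
Qed.

(** If the probability were below [1/6], the events that spoil [norm_rigidity] would not cover the
    space, and an outcome outside them would force [||s| - a| < 19 t]. *)
Lemma increment_escape k N (a b q t : R) (s : H) :
  (k <= N <= n)%N -> (N <= k.*2)%N -> 0 < a -> q < 6^-1 ->
  (P [set w | t <= `| `|S k w| - a |]%R <= q%:E)%E ->
  (P [set w | t <= `| `|S N w| - b |]%R <= q%:E)%E ->
  19 * t <= `| `|s| - a | ->
  ((6^-1)%:E <= P [set w | t <= `| `|s + (D k N w : H)| - b |]%R)%E.
Proof.
move=> /andP[kN Nn] N2k a0 q6 Pk PN hs; rewrite leNgt; apply/negP => /ltW Ps.
have mk := measurable_dist_partial_sum k a t.
have mN := measurable_dist_partial_sum N b t.
have mD (A : set (borel H)) : measurable A -> measurable [set w | A (D k N w)].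
  by move=> mA; rewrite -[mkset _]setTI; exact: measurable_ss.
(* Three bad events have probability at most [q], [q] and [2 q], in total below 1. Outside them
   [|S_k|] and [|D|] are below [a + t], while [|S_N| > b - t]. *)
have ba : b < 2 * a + 3 * t.
  have PD : (P [set w | a + t <= `|D k N w : H|]%R <= (q + q)%:E)%E.
    apply: increment_tail => //; first by rewrite kN.
    apply: le_trans Pk; apply: le_measure; rewrite ?inE//.
      rewrite (_ : mkset _ = S k @^-1` [set x : H | a + t <= `|x|])//.
      rewrite -[_ @^-1` _]setTI; apply: measurable_partial_sum => //.
      exact: measurable_norm_ge.
    move=> w /= atS; apply: le_trans (ler_norm _).
    by rewrite lerBrDr addrC.
  have mD' := mD _ (measurable_norm_ge (a + t)).
  have := probabilityU_le (measurableU _ _ mk mN) mD'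
    (probabilityU_le mk mN Pk PN) PD.
  case/probability_ex_notin; first by lra.
  move=> w /not_orP[/not_orP[/= /negP + /negP +] /negP].
  rewrite -!ltNge (partial_sumD _ kN).
  have := ler_normD (S k w) (D k N w : H).
  rewrite !ltr_norml => h /andP[_ h1] /andP[h2 _] h3.
  have {}h := le_lt_trans h (ltrD (_ : _ < a + t) h3).
  have : `|S k w| < a + t by rewrite addrC -ltrBlDr.
  by move=> /h; lra.
have Ps' : (P [set w | t <= `| `|s - (D k N w : H)| - b |]%R <= (6^-1)%:E)%E.
  by have := increment_reflection k N (measurable_shift_dist_norm_ge s b t) => ->.
have PN' : (P [set w | t <= `| `|S k w - (D k N w : H)| - b |]%R <= q%:E)%E.
  by have := partial_sum_reflection kN (measurable_dist_norm_ge b t) => ->.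
have m1 := mD _ (measurable_shift_dist_norm_ge s b t).
have m2 : measurable [set w | t <= `| `|s - (D k N w : H)| - b |].
  rewrite (_ : mkset _ = signed_sum X (fun=> true) (block k N) @^-1`
    [set x | t <= `| `|s + (x : H)| - b |]).
    rewrite -[_ @^-1` _]setTI; apply: measurable_ss => //.
    exact: measurable_shift_dist_norm_ge.
  by apply/funext => w; rewrite /preimage/= signed_sumN.
have m3 : measurable [set w | t <= `| `|S k w - (D k N w : H)| - b |].
  rewrite (_ : mkset _ = signed_sum X (fun m => (k <= m)%N) (block 0 N) @^-1`
    [set x : H | t <= `| `|x| - b |]).
    rewrite -[_ @^-1` _]setTI; apply: measurable_ss => //.
    exact: measurable_dist_norm_ge.
  by apply/funext => w; rewrite /preimage/= partial_sum_flip.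
(* Five bad events: those for [s + D] and [s - D] have probability at most [1/6], the other three at
   most [q < 1/6]; the total is below 1. *)
have := probabilityU_le
  (measurableU _ _ (measurableU _ _ m1 m2) (measurableU _ _ m3 mN)) mk
  (probabilityU_le (measurableU _ _ m1 m2) (measurableU _ _ m3 mN)
    (probabilityU_le m1 m2 Ps Ps') (probabilityU_le m3 mN PN' PN)) Pk.
case/probability_ex_notin; first by lra.
move=> w /not_orP[/not_orP[/not_orP[]]]/= /negP + /negP + /not_orP[]/= /negP +
  /negP + /negP.
rewrite -!ltNge (partial_sumD _ kN) => h1 h2 h3 h4 h5.
by have := norm_rigidity a0 ba h1 h2 h4 h3 h5; rewrite ltNge hs.
Qed.

(** * First-passage decomposition and the maximal inequality *)

Let early K : {set 'I_n} := [set m : 'I_n | (m < K)%N]%SET.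

Lemma measurable_early_dist l K (b u : R) : (l <= K)%N ->
  <<s cylinders X (early K) >> [set w | u <= `| `|S l w| - b |].
Proof.
move=> lK; have mS : measurable_fun
    (setT : set (g_sigma_algebraType (cylinders X (early K))))
    (D 0%N l).
  apply: (measurable_signed_sum_cylinders hH) => m.
  by rewrite mem_block inE => /leq_trans; apply.
rewrite (_ : mkset _ = D 0%N l @^-1` [set x : H | u <= `| `|x| - b |]).
  by rewrite -[_ @^-1` _]setTI; apply: mS => //; exact: measurable_dist_norm_ge.
by apply/funext => w; rewrite /preimage/= partial_sum_block.
Qed.

(* Fubini for the law of the pair [(id, D K N)], where [id] maps [T] to [T]
   equipped with the sigma-algebra generated by [X_1, ..., X_K]. *)
Lemma early_event_le K N (E : set T) (b c t : R) :
  (K <= N)%N -> <<s cylinders X (early K) >> E -> 0 <= c ->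
  (forall w, E w ->
    (c%:E <= P [set v | t <= `| `|S K w + (D K N v : H)| - b |]%R)%E) ->
  (c%:E * P E <= P (E `&` [set w | t <= `| `|S N w| - b |]%R))%E.
Proof.
move=> KN sE c0 hE.
(* Taking the outcome itself as first component lets [E] depend on all of the first [K] variables,
   not only on [S K]. *)
have mid : measurable_fun [set: T]
    (fun w : T => w : g_sigma_algebraType (cylinders X (early K))).
  by move=> _ A mA; rewrite setTI; exact: (cylinders_sub_measurable mA).
have [W WE] := measurable_fun_RV P mid.
have [Y YE] := measurable_fun_RV P (measurable_ss (fun=> false) (block K N)).
pose C : set (g_sigma_algebraType (cylinders X (early K)) * borel H) :=
  [set p | t <= `| `|(D 0%N K p.1 : H) + (p.2 : H)| - b |].
have mC : measurable C.
  have mf : measurable_fun setT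
      (fun p : g_sigma_algebraType (cylinders X (early K)) * borel H =>
        (D 0%N K p.1 : H) + (p.2 : H) : borel H).
    apply: (measurable_funD_borel hH); last exact: measurable_snd.
    apply: (measurableT_comp _ measurable_fst).
    apply: (measurable_signed_sum_cylinders hH) => m.
    by rewrite mem_block inE.
  rewrite -[C]setTI.
  exact: (mf measurableT _ (measurable_dist_norm_ge b t)).
have WY A B : measurable A -> measurable B ->
    P (W @^-1` A `&` Y @^-1` B) = (P (W @^-1` A) * P (Y @^-1` B))%E.
  move=> mA mB; rewrite WE YE.
  apply: (@cylinders_indep _ _ _ _ _ _ _ Xindep (early K) (finset (mem (block K N)))).
  - by move=> m; rewrite !inE mem_block => mK; rewrite negb_and -ltnNge mK.
  - exact: mA.
  - rewrite -[_ @^-1` _]setTI.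
    apply: (measurable_signed_sum_cylinders hH) => // m.
    by rewrite inE.
have := joint_law_ge WY sE mC c0.
rewrite WE YE; set G := _ @^-1` C.
rewrite (_ : G = [set w | t <= `| `|S N w| - b |]); last first.
  by apply/funext => w; rewrite /G/preimage/C/= (partial_sumD _ KN) partial_sum_block.
apply=> w /hE; rewrite /xsection/= => h; apply: le_trans h _.
rewrite le_eqVlt; apply/orP; left; apply/eqP; congr (P _).
by apply/funext => v; rewrite /preimage /= inE partial_sum_block.
Qed.

Lemma maximal_ineq_half (i N : nat) (a : nat -> R) (q t : R) :
  (i <= N <= n)%N -> (N <= i.*2)%N ->
  (forall k, (i <= k <= N)%N -> 0 < a k) -> q < 6^-1 ->
  (forall k, (i <= k <= N)%N ->
    (P [set w | t <= `| `|S k w| - a k |]%R <= q%:E)%E) ->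
  (P [set w | exists2 k, (i <= k <= N)%N & (19 * t <= `| `|S k w| - a k |)%R]
   <= (6 * q)%:E)%E.
Proof.
move=> /andP[iN Nn] N2i a0 q6 Pq.
pose U K := [set w | exists2 k, (i <= k < K)%N & 19 * t <= `| `|S k w| - a k |].
pose F := [set w | t <= `| `|S N w| - a N |].
have mF : measurable F by exact: measurable_dist_partial_sum.
have sU K : <<s cylinders X (early K) >> (U K).
  rewrite (_ : U K = \bigcup_(k in [set k | (i <= k < K)%N])
    [set w | 19 * t <= `| `|S k w| - a k |]) //.
  apply: (@bigcup_measurable _ (g_sigma_algebraType (cylinders X (early K)))).
  by move=> k /andP[_ /ltnW kK]; exact: measurable_early_dist.
have mU K : measurable (U K) by exact: (cylinders_sub_measurable (sU K)).
(* Induction on [K]: [U K.+1] adds to [U K] the disjoint event [E] of a first exceedance at time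
   [K], and intersecting [E] with [F] loses at most a factor 6. The range ends at [N.+1] because
   [U K] only sees times before [K]. *)
have main K : (i <= K <= N.+1)%N -> ((6^-1)%:E * P (U K) <= P (U K `&` F))%E.
  elim: K => [|K IH] /andP[iK KN].
    rewrite (_ : U 0%N = set0) ?measure0 ?mule0//.
    by rewrite -subset0 => w [k]; rewrite ltn0 andbF.
  have [iK'|Ki] := leqP i K; last first.
    rewrite (_ : U _ = set0) ?measure0 ?mule0//.
    rewrite -subset0 => w [k /andP[ik kK]].
    by have := leq_ltn_trans ik (leq_trans kK Ki); rewrite ltnn.
  pose E := [set w | 19 * t <= `| `|S K w| - a K |] `\` U K.
  have sE : <<s cylinders X (early K) >> E.
    by apply: (@measurableD _ (g_sigma_algebraType (cylinders X (early K))));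
      [exact: measurable_early_dist|exact: sU].
  have mE : measurable E by exact: (cylinders_sub_measurable sE).
  have UE : U K.+1 = U K `|` E.
    apply/seteqP; split => w /=.
      move=> [k /andP[ik]]; rewrite ltnS leq_eqVlt => /orP[/eqP -> hk|kK hk].
        by have [|] := pselect (U K w); [left|right].
      by left; exists k => //; rewrite ik.
    move=> [[k /andP[ik kK] hk]|[hK _]].
      by exists k => //; rewrite ik ltnW.
    by exists K => //; rewrite iK' /=.
  have UE0 : U K `&` E = set0.
    by rewrite -subset0 => w [] ? [].
  rewrite UE setIUl !measureU//; first last.
  - by rewrite setIACA UE0 set0I.
  - exact: measurableI.
  - exact: measurableI.
  rewrite ge0_muleDr//; apply: leeD; first by apply: IH; rewrite iK' ltnW.
  apply: (@early_event_le K N E (a N) 6^-1 t KN sE) => // w [/= wK _].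
  have KNn : (i <= K <= N)%N by rewrite iK'.
  apply: (@increment_escape K N (a K) (a N) q t (S K w)) => //.
  - by rewrite -ltnS KN.
  - by apply: leq_trans N2i _; rewrite leq_double.
  - exact: a0.
  - exact: Pq.
  - by apply: Pq; rewrite iN leqnn.
have := main N.+1; rewrite leqnn (leq_trans iN)// => /(_ isT) h.
rewrite -[leLHS]/(P (U N.+1)).
have : ((6^-1)%:E * P (U N.+1) <= q%:E)%E.
  apply: le_trans h _; apply: le_trans (Pq N _); last by rewrite iN leqnn.
  by apply: le_measure; rewrite ?inE//; exact: measurableI.
rewrite -[P _]fineK ?fin_num_measure// -EFinM !lee_fin.
by rewrite mulrC ler_pdivrMr// mulrC.
Qed.

Lemma measurable_exists_dist i N (a : nat -> R) (u : R) :
  measurable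
    [set w | exists2 k, (i <= k <= N)%N & u <= `| `|S k w| - a k |].
Proof.
rewrite (_ : mkset _ = \bigcup_(k in [set k | (i <= k <= N)%N])
  [set w | u <= `| `|S k w| - a k |])//.
by apply: bigcup_measurable => k _; exact: measurable_dist_partial_sum.
Qed.

Lemma maximal_ineq_dyadic (j i N : nat) (a : nat -> R) (q t : R) :
  (i <= N <= n)%N -> (N <= 2 ^ j.+1 * i)%N ->
  (forall k, (i <= k <= N)%N -> 0 < a k) -> q < 6^-1 ->
  (forall k, (i <= k <= N)%N ->
    (P [set w | t <= `| `|S k w| - a k |]%R <= q%:E)%E) ->
  (P [set w | exists2 k, (i <= k <= N)%N & (19 * t <= `| `|S k w| - a k |)%R]
   <= ((6 * j.+1)%:R * q)%:E)%E.
Proof.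
elim: j N => [|j IH] N /andP[iN Nn] N2i a0 q6 Pq.
  rewrite muln1; apply: maximal_ineq_half => //; first by rewrite iN.
  by rewrite -mul2n -[X in (_ <= X * _)%N]expn1.
(* [uphalf] rounds up, so [N <= 2 M] and the previous bound covers [[M, N]]; [M <= 2 ^ j.+1 * i]
   leaves [[i, M]] to the induction. *)
pose M := maxn i (uphalf N).
have iM : (i <= M)%N by exact: leq_maxl.
have MN : (M <= N)%N by rewrite geq_max iN; lia.
have N2M : (N <= M.*2)%N by rewrite /M; lia.
have M2i : (M <= 2 ^ j.+1 * i)%N.
  have : (i <= 2 ^ j.+1 * i)%N by rewrite leq_pmull// expn_gt0.
  by move: N2i; rewrite /M (expnS _ j.+1); lia.
have low : forall k, (i <= k <= M)%N -> (i <= k <= N)%N.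
  by move=> k /andP[-> /leq_trans]; apply.
have high : forall k, (M <= k <= N)%N -> (i <= k <= N)%N.
  by move=> k /andP[/(leq_trans iM)->].
rewrite (_ : (6 * j.+2)%:R * q = (6 * j.+1)%:R * q + 6 * q); last first.
  by rewrite mulnS natrD mulrDl addrC.
apply: le_trans (probabilityU_le (measurable_exists_dist i M a (19 * t))
  (measurable_exists_dist M N a (19 * t)) _ _); last first.
- apply: maximal_ineq_half => //; first by rewrite MN.
  + by move=> k /high; exact: a0.
  + by move=> k /high; exact: Pq.
- apply: IH => //; first by rewrite iM (leq_trans MN).
  + by move=> k /low; exact: a0.
  + by move=> k /low; exact: Pq.
apply: le_measure; rewrite ?inE; first exact: measurable_exists_dist.
  by apply: measurableU; exact: measurable_exists_dist.
move=> w [k /andP[ik kN] hk]; have [kM|/ltnW Mk] := leqP k M.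
  by left; exists k; rewrite ?ik.
by right; exists k; rewrite ?Mk.
Qed.

End iid_symmetric.

(** * Maxima over ranges and the conclusion *)

(** Positivity of [u] keeps the default value 0 of the maximum below [u]. *)
Lemma le_bigmax_natP (R : realDomainType) (m n : nat) (f : nat -> R) (u : R) :
  0 < u -> u <= \big[Num.max/0]_(m <= k < n) f k <->
  exists2 k, (m <= k < n)%N & u <= f k.
Proof.
move=> u0; split=> [hu|[k kmn ufk]]; last first.
  by apply: (bigmax_sup_seq _ k) => //; rewrite mem_index_iota.
apply: contrapT => hf; have := hu; apply/negP; rewrite -ltNge big_nat.
apply: (big_ind (fun y => y < u)) => // [x y xu yu|k kmn]; first by rewrite gt_max xu.
by rewrite ltNge; apply/negP => ufk; apply: hf; exists k.
Qed.

Theorem corollary1p5 (R : realType) (H : hilbertType R)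
    (hH : separable H)
    (d : measure_display) (T : measurableType d) (P : probability T R)
    (n : nat) (hn : (1 <= n)%N) (X : 'I_n -> {RV P >-> borel H})
    (Xsym : forall m, symmetric_rv P (X m))
    (Xindep : mutually_independent P X)
    (Xid : identically_distributed P X)
    (j : nat) (hj : (1 <= j)%N)
    (i : nat) (hi : n%:R / 2 ^+ j <= i%:R :> R) (hin : (i <= n)%N)
    (a : nat -> R) (ha : forall k, (i <= k <= n)%N -> 0 < a k)
    (t : R) (ht : 0 <= t) :
  (P [set w | 19 * t <= \big[Num.max/0]_(i <= k < n.+1)
                          `| `|partial_sum X k w| - a k |]%R
   <= (6 * j)%:R%:E *
      \big[maxe/-oo]_(i <= k < n.+1)
         P [set w | t <= `| `|partial_sum X k w| - a k |]%R)%E.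
Proof.
set L := [set w | 19 * t <= _]; set Q := (\big[maxe/-oo]_(_ <= _ < _) _)%E.
have mB k : measurable [set w | t <= `| `|partial_sum X k w| - a k |].
  exact: measurable_dist_partial_sum.
have leQ k : (i <= k <= n)%N ->
    (P [set w | t <= `| `|partial_sum X k w| - a k |]%R <= Q)%E.
  move=> kin; apply: (le_bigmax_seq -oo%E k predT
    (fun k => P [set w | t <= `| `|partial_sum X k w| - a k |]%R)) => //.
  by rewrite mem_index_iota ltnS.
have Q1 : (Q <= 1)%E.
  by apply: bigmax_le; [exact: leNye|move=> k _; exact: probability_le1].
(* As [i <= n], the range contains [n], so [Q] is not the default [-oo]. *)
have Q0 : (0 <= Q)%E.
  by apply: le_trans (leQ n _) => //; rewrite hin leqnn.
have [q QE] : exists q, Q = q%:E.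
  by exists (fine Q); rewrite fineK// ge0_fin_numE// (le_lt_trans Q1)// ltry.
have LE : 0 < t ->
    L = [set w | exists2 k, (i <= k <= n)%N &
           19 * t <= `| `|partial_sum X k w| - a k |].
  move=> t0; apply/seteqP; split => w /=.
    by move/le_bigmax_natP; apply; exact: mulr_gt0.
  by move=> hw; apply/le_bigmax_natP => //; exact: mulr_gt0.
have mL : measurable L.
  have [t0|] := ltP 0 t.
    by rewrite LE//; exact: measurable_exists_dist.
  move=> t0; rewrite (_ : L = setT)// -subTset => w _ /=.
  apply: (@le_trans _ _ 0); first by rewrite pmulr_rle0.
  exact: bigmax_ge_id.
(* If [q >= 1/6], the right side is at least [j >= 1]. *)
rewrite QE -EFinM; have [q6|q6] := ltP q 6^-1; last first.
  apply: le_trans (probability_le1 P mL) _; rewrite lee_fin natrM.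
  have : 1 <= j%:R :> R by rewrite ler1n.
  by move: q6; nra.
(* For [t = 0] the event at [k = n] is the whole space, which would give [q >= 1]. *)
have t0 : 0 < t.
  rewrite ltNge; apply/negP => t0; have := leQ n; rewrite hin leqnn => /(_ isT).
  rewrite (_ : mkset _ = setT) ?probability_setT ?QE ?lee_fin; first lra.
  by rewrite -subTset => w _ /=; exact: le_trans t0 _.
rewrite LE// -(prednK hj); apply: maximal_ineq_dyadic => //.
- by rewrite hin leqnn.
(* Hypothesis [hi], read in the natural numbers, is [n <= 2 ^ j * i]. *)
- rewrite (prednK hj) mulnC -(ler_nat R) natrM natrX.
  by rewrite -ler_pdivrMr// exprn_gt0.
- by move=> k kin; rewrite -QE; exact: leQ.
Qed.
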